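(* Let $\alpha\colon G\curvearrowright X$ and $\beta\colon H\curvearrowright Y$ be actions of discrete groups on locally compact Hausdorff spaces. If $\alpha$ and $\beta$ are continuously orbit equivalent, then $\dim_{\mathrm{LTC}}(\alpha)=\dim_{\mathrm{LTC}}(\beta)$.
   Context: $\alpha$ and $\beta$ are continuously orbit equivalent if there exist a homeomorphism $\varphi\colon X\to Y$ and continuous maps $a\colon G\times X\to H$ and $b\colon H\times Y\to G$ such that $\varphi(\alpha_g(x))=\beta_{a(g,x)}(\varphi(x))$ for all $g\in G$, $x\in X$ and $\varphi^{-1}(\beta_h(y))=\alpha_{b(h,y)}(\varphi^{-1}(y))$ for all $h\in H$, $y\in Y$. Long thin covering dimension: write $\alpha_L(x)=\{\alpha_g(x)\colon g\in L\}$, and let $\operatorname{mult}(\mathcal{U})=\sup_{x\in X}|\{U\in\mathcal{U}\colon x\in U\}|$; $\Subset$ means compact subset (finite subset in a discrete group). $\dim_{\mathrm{LTC}}(\alpha)$ is the infimum (possibly $\infty$) of all natural numbers $d$ satisfying: for any finite $L\Subset G$ and any compact $K\Subset X$ there is a natural number $N$ such that for any finite open cover $\mathcal{V}$ of $X$ there exist a collection $\mathcal{U}$ of open sets in $X$ and locally constant functions $\Lambda_U\colon U\to X$ ($U\in\mathcal{U}$) satisfying: (Lo) for any $x\in K$ there is $U\in\mathcal{U}$ with $\alpha_L(x)\subseteq U$; (Mu) $\operatorname{mult}(\mathcal{U})\leq d+1$; (Eq) for any $U\in\mathcal{U}$, $x\in U$, $g\in L$, if $\alpha_g(x)\in U$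 then $\Lambda_U(\alpha_g(x))=\alpha_g(\Lambda_U(x))$; (Th) for any $U\in\mathcal{U}$ and $y\in\Lambda_U(U)$ there is $V\in\mathcal{V}$ with $\Lambda_U^{-1}(y)\cup\{y\}\subseteq V$; (Ca) $|\Lambda_U(U)|\leq N$ for any $U\in\mathcal{U}$. *)

(* Defs.v *)
From HB Require Import structures.
From mathcomp Require Import all_boot all_order all_algebra.
From mathcomp Require Import all_classical all_reals all_analysis.

Set Implicit Arguments.
Unset Strict Implicit.
Unset Printing Implicit Defensive.

Local Open Scope classical_set_scope.
Local Open Scope card_scope.
Local Open Scope group_scope.

(* The type [G] carries no topology: it stands for a discrete group, so an
   action is continuous as soon as each [act g] is (hence each [act g] is a
   homeomorphism, with inverse [act g^-1]). *)
Record action (G : groupType) (X : topologicalType) := Action {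
  act :> G -> X -> X;
  act1 : forall x, act 1 x = x;
  actM : forall g h x, act (g * h) x = act g (act h x);
  act_continuous : forall g, continuous (act g) }.

Definition orbit_of (G : groupType) (X : topologicalType) (alpha : action G X)
    (L : set G) (x : X) : set X :=
  [set alpha g x | g in L].

Definition homeomorphism (X Y : topologicalType) (phi : X -> Y)
    (psi : Y -> X) : Prop :=
  [/\ cancel phi psi, cancel psi phi, continuous phi & continuous psi].

Definition continuously_orbit_equivalent (G H : groupType)
    (X Y : topologicalType) (alpha : action G X) (beta : action H Y) : Prop :=
  exists (phi : X -> Y) (psi : Y -> X)
         (a : discrete_topology G * X -> discrete_topology H)
         (b : discrete_topology H * Y -> discrete_topology G),
    [/\ homeomorphism phi psi, continuous a, continuous b,
        forall g x, phi (alpha g x) = beta (a (g, x)) (phi x)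
      & forall h y, psi (beta h y) = alpha (b (h, y)) (psi y)].

(* [counting A] is the number of elements of [A], or [+oo]; the real type [R]
   only serves to form the extended numbers [\bar R]. *)
Definition mult (R : realType) (X : topologicalType) (Us : set (set X)) :
    \bar R :=
  ereal_sup [set counting [set U | Us U /\ U x] | x in [set: X]].

Definition finite_open_cover (X : topologicalType) (Vs : set (set X)) : Prop :=
  [/\ finite_set Vs, forall V, Vs V -> open V & \bigcup_(V in Vs) V = [set: X]].

Definition locally_constant_on (X : topologicalType) (T : Type) (U : set X)
    (f : X -> T) : Prop :=
  forall x, U x -> \forall y \near x, U y -> f y = f x.

(* The maps [Lam U : X -> X] are only ever used on [U]; they represent maps
   defined on [U] alone, as any such map extends to [X] by the identity. *)
Definition LTC_cover (R : realType) (G : groupType) (X : topologicalType)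
    (alpha : action G X) (d : nat) (L : set G) (K : set X) (N : nat)
    (Vs Us : set (set X)) (Lam : set X -> X -> X) : Prop :=
  [/\ forall x, K x -> exists2 U, Us U & orbit_of alpha L x `<=` U,
      (mult R Us <= d.+1%:R%:E)%E,
      forall U x g, Us U -> U x -> L g -> U (alpha g x) ->
        Lam U (alpha g x) = alpha g (Lam U x),
      forall U y, Us U -> (Lam U @` U) y ->
        exists2 V, Vs V & (U `&` Lam U @^-1` [set y]) `|` [set y] `<=` V
    & forall U, Us U -> Lam U @` U #<= `I_N].

Definition LTC_bound (R : realType) (G : groupType) (X : topologicalType)
    (alpha : action G X) (d : nat) : Prop :=
  forall (L : set G) (K : set X), finite_set L -> compact K ->
  exists N : nat, forall Vs : set (set X), finite_open_cover Vs ->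
  exists (Us : set (set X)) (Lam : set X -> X -> X),
    [/\ forall U, Us U -> open U,
        forall U, Us U -> locally_constant_on U (Lam U)
      & LTC_cover R alpha d L K N Vs Us Lam].

(* The infimum of the empty set is [+oo]. *)
Definition dim_LTC (R : realType) (G : groupType) (X : topologicalType)
    (alpha : action G X) : \bar R :=
  ereal_inf [set d%:R%:E | d in [set d : nat | LTC_bound R alpha d]].

(* Main.v *)
Require Import Defs.
From mathcomp Require Import all_boot all_order all_algebra.
From mathcomp Require Import all_classical all_reals all_analysis.

(** Let [L] be a finite set of elements of [H] and [K] a compact set in [Y].
    The cocycle [b] takes only finitely many values [F] on [L * (K `|` beta_L K)],
    and [beta_h] agrees with [alpha_(b (h, y))].  A cover for [alpha], [F] and
    [psi K] is transported to [Y] and restricted to the clopen set where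
    [b (h, -)] has values in [F] for all [h] in [L].  If the given cover is first
    refined so that on each piece [b (h, -)] is constant as soon as it meets [F],
    then (Th) forces [b (h, Lambda_U y) = b (h, y)], so that the equivariance of
    [Lambda_U] under [F] becomes its equivariance under [L]. *)

Set Implicit Arguments.
Unset Strict Implicit.
Unset Printing Implicit Defensive.

Import Order.TTheory Num.Theory.
Local Open Scope classical_set_scope.
Local Open Scope card_scope.

(** The fibres of [f] form a partition of [X] into open sets, so finitely many of them cover [K]. *)
Lemma finite_image_compact (X : topologicalType) (T : Type) (f : X -> T)
    (K : set X) :
  (forall S : set T, open (f @^-1` S)) -> compact K -> finite_set (f @` K).
Proof.
move=> f_open /compact_near_coveringP cK.
(* The filter of large finite sets turns near-compactness into finiteness. *)
pose F : set_system (set T) :=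
  [set P | exists2 A, finite_set A & forall B, A `<=` B -> P B].
have FF : Filter F.
  split.
  - by exists set0.
  - move=> P Q [A finA PA] [B finB QB]; exists (A `|` B).
      by rewrite finite_setU.
    by move=> C ABC; split; [apply: PA|apply: QB] => t tAB; apply: ABC;
      [left|right].
  - by move=> P Q PQ [A finA PA]; exists A => // B /PA /PQ.
have [|A finA /(_ _ (@subset_refl _ A)) KA] := cK _ F (fun B x => B (f x)) FF.
  move=> x Kx.
  exists (f @^-1` [set f x], [set B : set T | B (f x)]) => /=.
    split; first exact: open_nbhs_nbhs.
    by exists [set f x] => // B; apply.
  by move=> [y B] [/= ->].
by apply: sub_finite_set finA => _ [x Kx <-]; exact: KA.
Qed.

(** One index at a time, every piece is cut along the fibres of [f i] over the points of [F] and
    along the preimage of the complement of [F]. Lumping all values outside [F] together keeps the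
    cover finite; this is why constancy is claimed only where a value in [F] occurs. *)
Lemma finite_open_cover_refine (X : topologicalType) (I : choiceType)
    (T : Type) (f : I -> X -> T) (L : set I) (F : set T) (Vs : set (set X)) :
  (forall i S, open (f i @^-1` S)) -> finite_set L -> finite_set F ->
  finite_open_cover Vs ->
  exists2 Ws, finite_open_cover Ws &
    forall W, Ws W -> (exists2 V, Vs V & W `<=` V) /\
      (forall i x y, L i -> W x -> W y -> F (f i x) -> f i y = f i x).
Proof.
move=> f_open /finite_seqP[s ->] finF coverVs.
elim: s => [|j s [Ws [finWs openWs covWs] subWs]].
  by exists Vs => // V VsV; split => //; exists V.
pose Ps : set (set X) :=
  [set f j @^-1` S | S in [set [set t] | t in F] `|` [set ~` F]].
exists [set W `&` P | W in Ws & P in Ps].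
  split.
  - apply: finite_image2 => //; apply: finite_image.
    by rewrite finite_setU; split; [exact: finite_image|exact: finite_set1].
  - by move=> _ [W WsW [_ [S _ <-] <-]]; apply: openI; [exact: openWs|].
  - rewrite -subTset => x _; have : (\bigcup_(W in Ws) W) x by rewrite covWs.
    case=> W WsW Wx; have [Fx|nFx] := pselect (F (f j x)).
      exists (W `&` f j @^-1` [set f j x]) => //.
      exists W => //; exists (f j @^-1` [set f j x]) => //.
      by exists [set f j x] => //; left; exists (f j x).
    exists (W `&` f j @^-1` (~` F)) => //.
    exists W => //; exists (f j @^-1` (~` F)) => //.
    by exists (~` F) => //; right.
move=> _ [W WsW [_ [S S_F <-] <-]]; have [[V VsV WV] fW] := subWs _ WsW.
split; first by exists V => // x [/WV].
move=> i x y /=; rewrite inE => /orP[/eqP ->|si] [Wx Sx] [Wy Sy] Fx; last first.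
  exact: fW.
by case: S_F Sx Sy => [[t Ft <-] /= -> ->|->].
Qed.

Lemma counting_le (R : realType) (S T : choiceType) (A : set S) (B : set T) :
  A #<= B -> (@counting S R A <= @counting T R B)%E.
Proof.
move=> AB; rewrite /counting; case: asboolP => [finA|infA]; last first.
  by case: asboolP => [/(card_le_finite AB)//|_].
case: asboolP => [/finite_setP[n Bn]|_]; last exact: leey.
rewrite lee_fin ler_nat (card_fset_set Bn) geq_card_fset_set//.
by apply: card_le_trans AB _; have /card_eqPle[] := Bn.
Qed.

Lemma LTC_bound_transfer (R : realType) (G H : groupType)
    (X Y : topologicalType) (alpha : action G X) (beta : action H Y) (d : nat) :
  continuously_orbit_equivalent alpha beta ->
  LTC_bound R alpha d -> LTC_bound R beta d.
Proof.
move=> [phi [psi [_ [b [[phiK psiK cphi cpsi] _ cb _ bE]]]]] boundA L K finL cK.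
pose f (h : H) (y : Y) : G := b (h, y).
have f_open h (S : set G) : open (f h @^-1` S).
  have /continuousP cf : continuous (fun y => b (h, y)).
    move=> y; apply: (cvg_comp (fun z => (h : discrete_topology H, z))) (cb (h, y)).
    apply: (@cvg_pair _ _ _ (nbhs y) (nbhs (h : discrete_topology H)) (nbhs y)).
      exact: cvg_cst.
    exact: cvg_id.
  exact: cf (discrete_open _).
have betaE h y : beta h y = phi (alpha (f h y) (psi y)) by rewrite -bE psiK.
(* Both halves serve (Lo): the values on [K] place the [L]-orbit of a point of [K] in the preimage
   of some [U], and the values on the translates of [K] place it in the set [W] below. *)
pose F : set G := \bigcup_(h in L)
  (f h @` K `|` \bigcup_(k in L) f h @` (beta k @` K)).
have finF : finite_set F.
  apply: bigcup_finite => // h _; rewrite finite_setU; split.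
    exact: finite_image_compact.
  apply: bigcup_finite => // k _; apply: finite_image_compact => //.
  by apply: continuous_compact => //; apply: continuous_subspaceT;
    exact: act_continuous.
pose W : set Y := \bigcap_(h in L) (f h @^-1` F).
have openW : open W.
  rewrite openE => y Wy; have /finite_fsetP[D LD] := finL.
  rewrite /interior /W LD; apply: filter_bigI => h hD.
  by apply: open_nbhs_nbhs; split => //; apply: Wy; rewrite LD.
have cpsiK : compact (psi @` K).
  by apply: continuous_compact => //; exact: continuous_subspaceT.
(* [N] has to precede the cover [Vs], and it can: [F] and the image of [K] under [psi] are built
   without [Vs], which enters only through the refinement. *)
have [N boundN] := boundA F _ finF cpsiK.
exists N => Vs coverVs.
have [Ws [finWs openWs covWs] subWs] :=
  finite_open_cover_refine f_open finL finF coverVs.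
have coverX : finite_open_cover [set phi @^-1` V | V in Ws].
  split.
  - exact: finite_image.
  - by move=> _ [V WsV <-]; move/continuousP : cphi; apply; exact: openWs.
  - rewrite -subTset => x _; have : (\bigcup_(V in Ws) V) (phi x) by rewrite covWs.
    by case=> V WsV Vx; exists (phi @^-1` V) => //; exists V.
have [Us [Lam [openUs lcLam [Lo Mu Eq Th Ca]]]] := boundN _ coverX.
pose restr (U : set X) : set Y := psi @^-1` U `&` W.
(* Different [U] may have the same restriction, so one of them is chosen to define the locally
   constant map; the value [set0] is only a default outside the range of [restr]. *)
pose lift (U' : set Y) : set X :=
  if pselect (exists2 U, Us U & restr U = U') is left e then projT1 (cid2 e)
  else set0.
have liftP U' : (restr @` Us) U' -> Us (lift U') /\ restr (lift U') = U'.
  by move=> U'P; rewrite /lift; case: pselect => // e; case: (cid2 e).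
exists (restr @` Us), (fun U' => phi \o Lam (lift U') \o psi).
split.
- move=> _ [U UsU <-]; apply: openI => //.
  by move/continuousP : cpsi; apply; exact: openUs.
- move=> U' /liftP[]; move: (lift U') => U UsU <- y [Uy _].
  have : \forall z \near y, U (psi z) -> Lam U (psi z) = Lam U (psi y).
    exact: (cpsi y _ (lcLam _ UsU _ Uy)).
  by apply: filterS => z /= Uz [/Uz ->].
split.
- move=> y Ky; have [U UsU FU] := Lo (psi y) (imageP _ Ky).
  exists (restr U); first by exists U.
  move=> _ [h Lh <-]; split => /=.
    rewrite bE; apply: FU; exists (b (h, y)) => //.
    by exists h => //; left; exists y.
  move=> k Lk /=; exists k => //; right; exists h => //.
  by exists (beta h y) => //; exists y.
- apply: ge_ereal_sup => _ [y _ <-]; apply: le_trans Mu.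
  (* Identifying sets with equal restriction can only lower the multiplicity. *)
  apply: (@le_trans _ _ (counting [set U | Us U /\ U (psi y)])).
    apply: counting_le.
    apply: card_le_trans (card_image_le restr _); apply: subset_card_le.
    by move=> _ [[U UsU <-] [Uy _]]; exists U.
  by apply: ereal_sup_ubound; exists (psi y).
- move=> U' y h U'P; have [] := liftP _ U'P; move: (lift U') => U UsU <-.
  move=> [Uy Wy] Lh [Uhy _] /=.
  have Ffy := Wy _ Lh.
  (* The piece [V] of the refined cover contains both [y] and [phi (Lam U (psi y))]. Since [y] is in
     [W], the value [f h y] lies in [F], so [f h] agrees at the two points. *)
  have [|_ [V WsV <-] VT] := Th U (Lam U (psi y)) UsU; first by exists (psi y).
  have Vy : V y by rewrite -[y]psiK; apply: VT; left.
  have Vz : V (phi (Lam U (psi y))) by apply: VT; right.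
  have [_ /(_ h y _ Lh Vy Vz Ffy) fE] := subWs _ WsV.
  rewrite [in RHS]betaE fE phiK; congr phi.
  by rewrite bE; apply: Eq => //; rewrite -bE.
- move=> U' _ U'P [y + <-]; have [] := liftP _ U'P; move: (lift U') => U UsU <-.
  move=> [Uy _] /=.
  have [|_ [W' WsW' <-] W'T] := Th U (Lam U (psi y)) UsU; first by exists (psi y).
  have [[V VsV W'V] _] := subWs _ WsW'; exists V => // z zP; apply: W'V.
  case: zP => [[[Uz _] /= zE]|->]; last by apply: W'T; right.
  rewrite -[z]psiK; apply: W'T; left; split => //=.
  by rewrite -[LHS]phiK zE phiK.
- move=> U' U'P; have [] := liftP _ U'P; move: (lift U') => U UsU <-.
  apply: card_le_trans (Ca _ UsU).
  apply: card_le_trans (card_image_le phi _); apply: subset_card_le.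
  by move=> _ [y [Uy _] <-]; exists (Lam U (psi y)) => //; exists (psi y).
Qed.

Lemma continuously_orbit_equivalent_sym (G H : groupType)
    (X Y : topologicalType) (alpha : action G X) (beta : action H Y) :
  continuously_orbit_equivalent alpha beta ->
  continuously_orbit_equivalent beta alpha.
Proof.
move=> [phi [psi [a [b [[phiK psiK cphi cpsi] ca cb aE bE]]]]].
by exists psi, phi, b, a; split.
Qed.

Theorem proposition5p10 (R : realType) (G H : groupType)
    (X Y : topologicalType) (alpha : action G X) (beta : action H Y)
    (hX : hausdorff_space X) (lcX : locally_compact [set: X]%classic)
    (hY : hausdorff_space Y) (lcY : locally_compact [set: Y]%classic) :
  continuously_orbit_equivalent alpha beta ->
  dim_LTC R alpha = dim_LTC R beta.
Proof.
move=> coe; rewrite /dim_LTC; congr (ereal_inf [set _ | _ in _]).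
apply/seteqP; split=> d; apply: LTC_bound_transfer => //.
exact: continuously_orbit_equivalent_sym.
Qed.
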